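(* There exist absolute constants $\epsilon_0,\delta_0,K_0>0$ such that the following holds. For all $\epsilon\in(0,\epsilon_0)$, $\delta\in(0,\delta_0)$, $d\ge1/\epsilon^2$ and $n\ge K_0d^2/\delta$, if $\Pi\in\mathbb{R}^{m\times n}$ satisfies (i) the column sparsity of $\Pi$ is at most $1/(9\epsilon)$, (ii) the average number of $\sqrt{8\epsilon}$-heavy entries of $\Pi$ is at least $1/(12\epsilon)$, and (iii) $\Pi$ is an $(\epsilon,\delta)$-subspace-embedding for $U\sim\mathcal{D}_1$, then $m>d^2$.
   Context: The distribution $\mathcal{D}_1$ on $n\times d$ matrices is $U=VW$, where $V\in\mathbb{R}^{n\times d}$ has independent columns, each uniformly distributed over the $n$ standard basis vectors of $\mathbb{R}^n$, and $W\in\mathbb{R}^{d\times d}$ is a diagonal matrix with independent Rademacher ($\pm1$) diagonal entries, independent of $V$. A fixed $\Pi\in\mathbb{R}^{m\times n}$ is an $(\epsilon,\delta)$-subspace-embedding for $U\sim\mathcal{D}_1$ if $\Pr_{U}[\forall x\in\mathbb{R}^d,\ (1-\epsilon)\|Ux\|_2\le\|\Pi Ux\|_2\le(1+\epsilon)\|Ux\|_2]\ge1-\delta$. Column sparsity is the maximum number of nonzero entries in a column. A matrix entry is $\theta$-heavy if its absolute value is at least $\theta$; the average number of $\theta$-heavy entries of $\Pi$ is $\mathbb{E}_{j}[|\{i:|\Pi_{i,j}|\ge\theta\}|]$ with $j$ uniform on $\{1,\dots,n\}$. *)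

(* Defs.v *)
From mathcomp Require Import all_boot all_order all_algebra.
From mathcomp Require Import boolp reals.

Set Implicit Arguments.
Unset Strict Implicit.
Unset Printing Implicit Defensive.

Import GRing.Theory Num.Theory.
Local Open Scope ring_scope.

(* The norm on matrices provided by MathComp-Analysis is the sup norm.       *)
Definition l2norm (R : realType) (k : nat) (v : 'cV[R]_k) : R :=
  Num.sqrt (\sum_(i < k) v i 0 ^+ 2).

Definition unif (R : realType) (T : finType) (_ : T) : R := #|T|%:R^-1.

(* Sample space of D_1: column j of V is the standard basis vector of index  *)
(* w.1 j, and the j-th diagonal entry of W is -1 if w.2 j and 1 otherwise.   *)
Definition D1_sample (n d : nat) : finType :=
  ({ffun 'I_d -> 'I_n} * {ffun 'I_d -> bool})%type.

Definition D1_V (R : realType) (n d : nat) (w : D1_sample n d) : 'M[R]_(n, d) :=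
  \matrix_(i < n, j < d) (i == w.1 j)%:R.

Definition D1_W (R : realType) (n d : nat) (w : D1_sample n d) : 'M[R]_d :=
  diag_mx (\row_(j < d) (-1) ^+ w.2 j).

Definition D1_U (R : realType) (n d : nat) (w : D1_sample n d) : 'M[R]_(n, d) :=
  D1_V R w *m D1_W R w.

(* All the columns of V and all the diagonal entries of W are mutually       *)
(* independent, so the joint mass function is the product of the marginals.  *)
Definition D1_pmf (R : realType) (n d : nat) (w : D1_sample n d) : R :=
  (\prod_(j < d) unif R (w.1 j)) * (\prod_(j < d) unif R (w.2 j)).

Definition D1_Pr (R : realType) (n d : nat) (E : 'M[R]_(n, d) -> Prop) : R :=
  \sum_(w : D1_sample n d | `[< E (D1_U R w) >]) D1_pmf R w.

Definition subspace_embedding_D1 (R : realType) (m n d : nat)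
    (eps delta : R) (Pi : 'M[R]_(m, n)) : Prop :=
  D1_Pr (fun U : 'M[R]_(n, d) => forall x : 'cV[R]_d,
      (1 - eps) * l2norm (U *m x) <= l2norm (Pi *m U *m x) /\
      l2norm (Pi *m U *m x) <= (1 + eps) * l2norm (U *m x))
    >= 1 - delta.

Definition column_sparsity (R : realType) (m n : nat) (Pi : 'M[R]_(m, n)) : nat :=
  \max_(j < n) #|[set i : 'I_m | Pi i j != 0%R]|.

Definition avg_heavy (R : realType) (m n : nat) (theta : R)
    (Pi : 'M[R]_(m, n)) : R :=
  \sum_(j < n) unif R j * #|[set i : 'I_m | theta <= `|Pi i j|]|%:R.

(* Main.v *)
Require Import Defs.
From mathcomp Require Import all_boot all_order all_algebra.
From mathcomp Require Import boolp reals.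
From mathcomp Require Import ring lra.

Set Implicit Arguments.
Unset Strict Implicit.
Unset Printing Implicit Defensive.

Import Order.TTheory GRing.Theory Num.Theory.
Local Open Scope ring_scope.

(** Suppose [m <= d ^ 2].  Two distinct sampled columns of [Pi] whose inner
    product exceeds [2 eps] in absolute value ("conflict") destroy the embedding.
    Within a row, flip signs so that its heavy entries are positive; deleting the
    row leaves nonconflicting columns with inner product at most
    [2 eps - 8 eps = - 6 eps], and since a sum of vectors has nonnegative norm, a
    fraction at least [3 eps] of the pairs of columns heavy in that row conflict.
    Cauchy-Schwarz over the rows, together with the fact that a pair shares at
    most [1 / (9 eps)] rows, gives of the order of [n ^ 2 / m] conflicting pairs.

    To turn this into a constant failure probability, pass to a maximal subgraph
    of the conflict graph with degrees at most [D = n %/ d].  If at least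
    [n / 100] vertices are saturated, it has many edges; otherwise the saturated
    columns can be discarded before counting, and by maximality the subgraph
    contains all conflicts between the remaining ones.  In both cases it has at
    least [n ^ 2 / (200 d ^ 2)] edges, and the degree bound makes the second
    moment of the number of sampled edges small enough for the second moment
    method. *)

(** * Averages over uniformly random functions and resampling of one coordinate *)

Section Mean.
Variables (R : realFieldType) (I T : finType).
Implicit Types (w : {ffun I -> T}) (f g : {ffun I -> T} -> R).

Definition mean f : R := (\sum_w f w) / #|{ffun I -> T}|%:R.

Definition upd w (k : I) (v : T) : {ffun I -> T} :=
  [ffun i => if i == k then v else w i].

Lemma upd_same w k v : upd w k v k = v.
Proof. by rewrite ffunE eqxx. Qed.

Lemma upd_other w k v i : i != k -> upd w k v i = w i.
Proof. by move=> /negbTE ik; rewrite ffunE ik. Qed.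

Lemma eq_mean f g : f =1 g -> mean f = mean g.
Proof. by move=> fg; rewrite /mean (eq_bigr g). Qed.

Lemma mean_ge0 f : (forall w, 0 <= f w) -> 0 <= mean f.
Proof. by move=> f0; rewrite divr_ge0 // sumr_ge0. Qed.

Lemma ler_mean f g : (forall w, f w <= g w) -> mean f <= mean g.
Proof. by move=> fg; rewrite ler_wpM2r ?invr_ge0 // ler_sum. Qed.

Lemma meanZ c f : mean (fun w => c * f w) = c * mean f.
Proof. by rewrite /mean -mulr_sumr mulrA. Qed.

Lemma meanB f g : mean (fun w => f w - g w) = mean f - mean g.
Proof. by rewrite /mean sumrB mulrBl. Qed.

Lemma mean_sum (J : finType) (F : J -> {ffun I -> T} -> R) :
  mean (fun w => \sum_j F j w) = \sum_j mean (F j).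
Proof. by rewrite /mean exchange_big mulr_suml. Qed.

Lemma mean_eq0 f : f =1 (fun=> 0) -> mean f = 0.
Proof. by move=> f0; rewrite /mean big1 ?mul0r // => w _; rewrite f0. Qed.

Lemma mean_cst (c : R) : (0 < #|T|)%N -> mean (fun=> c) = c.
Proof.
move=> T0; rewrite /mean sumr_const -[c *+ _]mulr_natr mulfK //.
by rewrite pnatr_eq0 card_ffun -lt0n expn_gt0 T0.
Qed.

(* The map [(w, v) |-> (w with value v at k, w k)] is an involution. *)
Lemma mean_resample (k : I) f : (0 < #|T|)%N ->
  mean f = mean (fun w => (\sum_v f (upd w k v)) / #|T|%:R).
Proof.
move=> T0; rewrite /mean -mulr_suml; congr (_ / _).
have T0R : #|T|%:R != 0 :> R by rewrite pnatr_eq0 -lt0n.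
apply: (mulIf T0R); rewrite mulfVK //.
pose h (p : {ffun I -> T} * T) := (upd p.1 k p.2, p.1 k).
have hK : involutive h.
  move=> [w v]; rewrite /h /= upd_same; congr pair.
  by apply/ffunP => i; rewrite !ffunE; case: eqP => // ->.
rewrite pair_big /= (reindex_inj (inv_inj hK)) /=.
rewrite -(pair_big xpredT xpredT (fun w v => f (upd (upd w k v) k (w k)))) /=.
rewrite mulr_suml; apply: eq_bigr => w _.
rewrite (eq_bigr (fun=> f w)) ?sumr_const ?mulr_natr // => v _.
by congr f; apply/ffunP => i; rewrite !ffunE; case: eqP => // ->.
Qed.

Lemma mean_coord (k : I) (F : T -> R) : (0 < #|T|)%N ->
  mean (fun w => F (w k)) = (\sum_v F v) / #|T|%:R.
Proof.
move=> T0; rewrite (mean_resample k) // -[RHS]mean_cst //; apply: eq_mean => w.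
by under eq_bigr do rewrite upd_same.
Qed.

End Mean.

(** * Probability that random vertices of a bounded-degree graph span an edge *)

Section SecondMoment.
Variables (R : realFieldType) (I T : finType) (e : rel T).
Hypotheses (T_gt0 : (0 < #|T|)%N) (I_gt1 : (1 < #|I|)%N).
Hypotheses (e_sym : symmetric e) (e_irr : irreflexive e).
Hypothesis e_deg : forall x, (#|[set y | e x y]| * #|I| <= #|T|)%N.

Let d : R := #|I|%:R.
Let n : R := #|T|%:R.
Let ind (b : bool) : R := b%:R.
(** The edge density: the probability that two independent uniform vertices are adjacent. *)
Let q : R := (\sum_x \sum_y ind (e x y)) / n ^+ 2.
Let E (k l : I) (w : {ffun I -> T}) : R := ind (e (w k) (w l)).

Let n_gt0 : 0 < n. Proof. by rewrite ltr0n. Qed.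
Let d_gt1 : 1 < d. Proof. by rewrite ltr1n. Qed.
Let d_gt0 : 0 < d. Proof. exact: lt_trans d_gt1. Qed.
Let ind_ge0 b : 0 <= ind b. Proof. exact: ler0n. Qed.
Let ind1 : ind true = 1. Proof. by []. Qed.
Let ind0 : ind false = 0. Proof. by []. Qed.
Let q_ge0 : 0 <= q.
Proof. by rewrite divr_ge0 ?sqr_ge0 ?sumr_ge0 // => x _; rewrite sumr_ge0. Qed.

Let degE x : \sum_y ind (e x y) <= n / d.
Proof.
rewrite ler_pdivlMr // -natr_sum -natrM ler_nat.
by apply: leq_trans (e_deg x); rewrite -sum1dep_card [X in (_ <= X * _)%N]big_mkcond.
Qed.

(** Resampling coordinates [k] and [l] leaves [g] unchanged and averages the edge indicator to
    [q]. *)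
Let mean_disjoint (g : {ffun I -> T} -> R) k l : k != l ->
  (forall w v, g (upd w k v) = g w) -> (forall w v, g (upd w l v) = g w) ->
  mean (fun w => g w * E k l w) = mean g * q.
Proof.
move=> kl gk gl; rewrite (mean_resample l) // (mean_resample k) //.
rewrite mulrC -meanZ; apply: eq_mean => w.
transitivity ((\sum_x \sum_y ind (e x y)) * g w / n / n); last first.
  by rewrite /q; field; rewrite gt_eqF.
rewrite -mulr_suml; congr (_ / _ / _); rewrite mulr_suml.
apply: eq_bigr => x _; rewrite mulr_suml; apply: eq_bigr => y _.
by rewrite /E gl gk upd_same upd_other // upd_same mulrC.
Qed.

(** With all other coordinates fixed, a fresh [w l] falls among the at most [n / d] neighbours of
    [w k] with probability at most [1 / d]. *)
Let mean_adjacent (g : {ffun I -> T} -> R) k l : k != l ->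
  (forall w, 0 <= g w) -> (forall w v, g (upd w l v) = g w) ->
  mean (fun w => g w * E k l w) <= mean g / d.
Proof.
move=> kl g0 gl; rewrite (mean_resample l) // mulrC -meanZ.
apply: ler_mean => w; rewrite /E.
under eq_bigr do rewrite gl upd_same upd_other //.
rewrite -mulr_sumr -mulrA mulrC ler_wpM2r //.
by rewrite ler_pdivrMr // mulrC degE.
Qed.

Let mean_edge k l : k != l -> mean (E k l) = q.
Proof.
move=> kl; rewrite -[RHS]mul1r -(mean_cst I (1 : R) T_gt0) -(mean_disjoint kl) //.
by apply: eq_mean => w; rewrite mul1r.
Qed.

Let E_sym k l w : E k l w = E l k w. Proof. by rewrite /E e_sym. Qed.
Let E_idem k l w : E k l w * E k l w = E k l w.
Proof. by rewrite /E /ind; case: e; rewrite ?mulr1 ?mulr0. Qed.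
Let E_le1 k l w : E k l w <= 1.
Proof. by rewrite /E /ind; case: e. Qed.
Let E_upd k l i w v : i != k -> i != l -> E k l (upd w i v) = E k l w.
Proof. by move=> ik il; rewrite /E !upd_other // eq_sym. Qed.

(** Sharing no, one or both indices with [(k, l)] gives at most [q ^ 2], [q / d] or [q]. One formula
    dominates all the cases, so that it can be summed over [k'] and [l'] without a case split. *)
Let mean_two_edges k l k' l' : k != l ->
  mean (fun w => E k l w * E k' l' w)
    <= q * (q + (ind (k' \in [:: k; l]) + ind (l' \in [:: k; l])) / d +
            ind (k' \in [:: k; l]) * ind (l' \in [:: k; l])).
Proof.
set a := k' \in _; set b := l' \in _ => kl.
have dV : 0 <= d^-1 by rewrite invr_ge0 ltW.
have [kl'|kl'] := eqVneq k' l'.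
  have -> : mean (fun w => E k l w * E k' l' w) = 0.
    by apply: mean_eq0 => w; rewrite kl' /E e_irr mulr0.
  apply: mulr_ge0 => //; apply: addr_ge0; last exact: mulr_ge0.
  by apply: addr_ge0 => //; apply: mulr_ge0 => //; apply: addr_ge0.
have notin (i : I) : i \notin [:: k; l] ->
    forall w v, E k l (upd w i v) = E k l w.
  by rewrite !inE negb_or => /andP[ik il] w v; rewrite E_upd.
have E0 w : 0 <= E k l w by exact: ind_ge0.
case: (boolP a) (boolP b) => [ka|ka] [lb|lb]; rewrite ?ind1 ?ind0.
- apply: (@le_trans _ _ (mean (E k l))).
    by apply: ler_mean => w; rewrite ler_piMr.
  rewrite mean_edge // ler_peMr //; have := q_ge0; lra.
- apply: le_trans (mean_adjacent kl' E0 (notin _ lb)) _.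
  rewrite mean_edge // ler_wpM2l //; have := q_ge0; lra.
- under eq_mean do rewrite (E_sym k' l').
  rewrite eq_sym in kl'; apply: le_trans (mean_adjacent kl' E0 (notin _ ka)) _.
  rewrite mean_edge // ler_wpM2l //; have := q_ge0; lra.
- rewrite mean_disjoint ?mean_edge //; try exact: notin.
  rewrite ler_wpM2l //; have := q_ge0; lra.
Qed.

Let X w : R := \sum_k \sum_l E k l w.

(** With [X] the number of ordered sampled edges, [mean X = A] and the mean of [X ^ 2] is at most
    [A * (8 + B)], so [X] is nonzero with probability at least [A / (8 + B)]. *)
Lemma prob_edge_lb :
  d ^+ 2 * q / 2 / (8 + d ^+ 2 * q)
    <= mean (fun w : {ffun I -> T} => ind [exists k, exists l, e (w k) (w l)]).
Proof.
set B := d ^+ 2 * q; have B0 : 0 <= B by rewrite mulr_ge0 ?sqr_ge0.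
pose A := d * (d - 1) * q.
have sum_neq (c : R) : \sum_(k : I) \sum_(l | k != l) c = d * (d - 1) * c.
  under eq_bigr => k _.
    rewrite (eq_bigl (predC1 k)) => [|l]; last by rewrite /= eq_sym.
    rewrite sumr_const cardC1 -[c *+ _]mulr_natl -subn1 natrB; last exact: ltnW.
    over.
  by rewrite sumr_const -[LHS]mulr_natl mulrA.
have XE w : X w = \sum_k \sum_(l | k != l) E k l w.
  apply: eq_bigr => k _; rewrite [RHS]big_mkcond; apply: eq_bigr => l _.
  by case: eqVneq => //= ->; rewrite /E e_irr.
have EX : mean X = A.
  rewrite /A -sum_neq /X mean_sum; apply: eq_bigr => k _.
  rewrite mean_sum [RHS]big_mkcond; apply: eq_bigr => l _.
  case: eqVneq => [->|/= kl]; last exact: mean_edge.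
  by apply: mean_eq0 => w; rewrite /E e_irr.
have indIn (k l : I) : k != l -> \sum_(i : I) ind (i \in [:: k; l]) = 2.
  move=> kl; rewrite -natr_sum; congr (_%:R).
  rewrite -(big_mkcond (fun i => i \in [:: k; l]) (fun=> 1%N)) sum1_card.
  by rewrite (card_uniqP _) //= inE kl.
(* In the constant 8, a total of 4 comes from the terms [(g i + g j) / d] and 4 from the products
   [g i * g j]. *)
have sum_weights (r : R) (g : I -> R) : \sum_i g i = 2 ->
    \sum_i \sum_j r * (r + (g i + g j) / d + g i * g j) = r * (8 + d ^+ 2 * r).
  move=> g2; under eq_bigr => i _.
    rewrite -mulr_sumr !big_split /= -mulr_suml big_split /= -mulr_sumr g2.
    rewrite !sumr_const -[r *+ _]mulr_natl -[g i *+ _]mulr_natl -/d; over.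
  rewrite -mulr_sumr !big_split /= -!mulr_suml big_split /= -mulr_sumr g2.
  rewrite !sumr_const -[_ *+ #|I|]mulr_natl -[_ *+ #|I|]mulr_natl -/d.
  by field; rewrite gt_eqF.
have EklX k l : k != l -> mean (fun w => E k l w * X w) <= q * (8 + B).
  move=> kl; under eq_mean do rewrite mulr_sumr.
  rewrite mean_sum.
  apply: (@le_trans _ _ (\sum_i \sum_j q * (q +
      (ind (i \in [:: k; l]) + ind (j \in [:: k; l])) / d +
       ind (i \in [:: k; l]) * ind (j \in [:: k; l])))).
    apply: ler_sum => i _; under eq_mean do rewrite mulr_sumr.
    by rewrite mean_sum; apply: ler_sum => j _; apply: mean_two_edges.
  by rewrite (sum_weights q) ?indIn.
have EX2 : mean (fun w => X w * X w) <= A * (8 + B).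
  under eq_mean => w do rewrite [X in X * _]XE mulr_suml.
  rewrite mean_sum /A -mulrA -sum_neq ler_sum // => k _.
  under eq_mean do rewrite mulr_suml big_mkcond.
  rewrite mean_sum [leRHS]big_mkcond ler_sum // => l _.
  case: eqVneq => [_|/= kl]; last exact: EklX.
  by rewrite mean_eq0 // => w; rewrite mul0r.
have B8 : 0 < 8 + B by lra.
(* Since [d >= 2], [A] is at least [B / 2]. *)
apply: (@le_trans _ _ (A / (8 + B))).
  rewrite ler_pM2r ?invr_gt0 // /B /A -subr_ge0.
  have -> : d * (d - 1) * q - d ^+ 2 * q / 2 = d * (d - 2) * q / 2 by field.
  apply: divr_ge0 => //; apply: mulr_ge0 => //.
  by rewrite mulr_ge0 ?(ltW d_gt0) // subr_ge0 ler_nat.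
pose c := (8 + B)^-1.
have c0 : 0 < c by rewrite invr_gt0.
(* [2 t - t ^ 2 <= 1] at [t = c X], with equality to [0] when [X = 0]. *)
apply: (@le_trans _ _ (mean (fun w => 2 * c * X w - c ^+ 2 * (X w * X w)))).
  rewrite meanB !meanZ EX.
  apply: (@le_trans _ _ (2 * c * A - c ^+ 2 * (A * (8 + B)))).
    rewrite le_eqVlt; apply/orP; left; apply/eqP; rewrite /c.
    by field; rewrite gt_eqF.
  by rewrite lerB // ler_wpM2l // sqr_ge0.
apply: ler_mean => w; case: existsP => [_|noe].
  by rewrite /ind mulr1n; have := sqr_ge0 (c * X w - 1); lra.
have -> : X w = 0.
  rewrite /X big1 // => k _; rewrite big1 // => l _; rewrite /E.
  by case: (boolP (e _ _)) => // ekl; case: noe; exists k; apply/existsP; exists l.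
by rewrite /ind !mulr0 subrr.
Qed.

End SecondMoment.

(** * Maximal subgraphs of bounded degree *)

(** Take an inclusion-maximal symmetric set of edges with degrees at most [D]. A missing edge
    between two vertices of degree below [D] could be added in both orientations, against
    maximality. *)
Lemma maximal_bounded_subgraph (T : finType) (e : rel T) (D : nat) :
  symmetric e -> irreflexive e ->
  exists e' : rel T, [/\ symmetric e', subrel e' e,
    forall x, (#|[set z | e' x z]| <= D)%N &
    forall x y, e x y -> (#|[set z | e' x z]| < D)%N ->
      (#|[set z | e' y z]| < D)%N -> e' x y].
Proof.
move=> e_sym e_irr.
pose deg (M : {set T * T}) x := #|[set z | (x, z) \in M]|.
pose ok (M : {set T * T}) := [&& [forall p in M, e p.1 p.2],
  [forall p in M, (p.2, p.1) \in M] & [forall x, (deg M x <= D)%N]].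
have [|M /maxsetP[/and3P[/forall_inP Me /forall_inP Msym /forallP Mdeg] Mmax]] :=
    ex_maxset (P := ok).
  exists set0; apply/and3P; split; try by apply/forall_inP => p; rewrite inE.
  apply/forallP => x; rewrite /deg (_ : [set z | _] = set0) ?cards0 //.
  by apply/setP => z; rewrite !inE.
exists (fun x y => (x, y) \in M); split=> [x y|x y /Me|x|x y exy dx dy] //.
- by apply/idP/idP => /Msym.
- exact: Mdeg.
have xy : x != y by apply: contraTneq exy => ->; rewrite e_irr.
pose M' := (x, y) |: ((y, x) |: M).
have MM' : M \subset M' by apply/subsetP => p; rewrite !inE => ->; rewrite !orbT.
suff okM' : ok M' by rewrite -(Mmax _ okM' MM') !inE eqxx.
apply/and3P; split.
- apply/forall_inP => p; rewrite !inE => /or3P[/eqP->|/eqP->|/Me] //=.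
  by rewrite e_sym.
- apply/forall_inP => p; rewrite !inE => /or3P[/eqP->|/eqP->|/Msym->];
    by rewrite /= ?eqxx ?orbT.
apply/forallP => z; have [zx|zx] := eqVneq z x.
  apply: leq_trans (_ : #|y |: [set z | (x, z) \in M]| <= _)%N.
    apply/subset_leq_card/subsetP => t.
    by rewrite !inE zx !xpair_eqE eqxx (negbTE xy).
  by rewrite cardsU1; apply: leq_trans dx; rewrite -add1n leq_add2r leq_b1.
have [zy|zy] := eqVneq z y.
  apply: leq_trans (_ : #|x |: [set z | (y, z) \in M]| <= _)%N.
    apply/subset_leq_card/subsetP => t.
    by rewrite !inE zy !xpair_eqE eqxx eq_sym (negbTE xy).
  by rewrite cardsU1; apply: leq_trans dy; rewrite -add1n leq_add2r leq_b1.
apply: leq_trans (Mdeg z); apply/subset_leq_card/subsetP => t.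
by rewrite !inE !xpair_eqE (negbTE zx) (negbTE zy).
Qed.

(** * Inner products of columns, and conflicts forced by one row *)

Section Gram.
Variables (R : realFieldType) (m n : nat) (Pi : 'M[R]_(m, n)) (eps theta : R).
Hypotheses (eps_ge0 : 0 <= eps) (eps_le : eps <= 6^-1).
Hypotheses (theta_gt0 : 0 < theta) (theta2 : theta ^+ 2 = 8 * eps).

Definition gram (j l : 'I_n) : R := \sum_i Pi i j * Pi i l.
(** The threshold [2 * eps] is what accuracy [eps] on the sum and the difference of two basis
    vectors allows. *)
Definition conflict (j l : 'I_n) : bool := 2 * eps < `|gram j l|.

Lemma gramC j l : gram j l = gram l j.
Proof. by apply: eq_bigr => i _; rewrite mulrC. Qed.

(* Flip the columns so that row [i] is positive and delete it: two columns that
   do not conflict are left with inner product at most [- 6 eps], while the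
   squared norm of the sum of all of them is nonnegative. *)
Lemma heavy_row_conflicts (i : 'I_m) (C : {set 'I_n}) :
  {in C, forall j, theta <= `|Pi i j|} ->
  {in C, forall j, gram j j <= (1 + eps) ^+ 2} ->
  3 * eps * #|C|%:R ^+ 2 <= \sum_(j in C) \sum_(l in C) (conflict j l)%:R.
Proof.
move=> heavy normal; pose s j := Num.sg (Pi i j).
pose r j l := \sum_(k | k != i) Pi k j * Pi k l.
have gramE j l : gram j l = Pi i j * Pi i l + r j l by rewrite /gram (bigD1 i).
have s2 j : j \in C -> s j ^+ 2 = 1.
  move=> /heavy jh; rewrite sqr_sg; case: eqP => // pi0.
  by rewrite pi0 normr0 leNgt theta_gt0 in jh.
(* Deleting the row removes at least [8 * eps], which exceeds the excess [2 * eps + eps ^ 2]. *)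
have rjj j : j \in C -> r j j <= 1.
  move=> jC; have := normal j jC; rewrite gramE -expr2.
  rewrite -(real_normK (num_real (Pi i j))).
  have : theta ^+ 2 <= `|Pi i j| ^+ 2.
    by rewrite lerXn2r ?nnegrE ?(ltW theta_gt0) // heavy.
  have : eps ^+ 2 <= 6^-1 * eps by rewrite expr2; apply: ler_wpM2r.
  by rewrite theta2 sqrrD expr1n mul1r; have := eps_ge0; lra.
(* An affine function of the indicator covers both cases: at most 1 by the arithmetic-geometric mean
   inequality for a conflict, at most [- 6 * eps] otherwise. *)
have term j l : j \in C -> l \in C ->
    s j * s l * r j l <= (1 + 6 * eps) * (conflict j l)%:R - 6 * eps.
  move=> jC lC; case: (boolP (conflict j l)) => [_|nc].
    rewrite mulr1 addrK; apply: (@le_trans _ _ ((r j j + r l l) / 2)).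
      rewrite /r -big_split /= mulr_sumr mulr_suml; apply: ler_sum => k _.
      have := sqr_ge0 (s j * Pi k j - s l * Pi k l).
      by rewrite sqrrB !exprMn !s2 // !expr2; lra.
    by have := rjj j jC; have := rjj l lC; lra.
  have -> : r j l = gram j l - Pi i j * Pi i l by rewrite gramE addrC addKr.
  have nsg : `|s j * s l| = 1.
    apply/eqP; rewrite -(@eqrXn2 _ 2) ?normr_ge0 //.
    by rewrite expr1n real_normK ?num_real // exprMn !s2 ?mulr1.
  have h1 : s j * s l * gram j l <= 2 * eps.
    by apply: le_trans (ler_norm _) _; rewrite normrM nsg mul1r leNgt.
  have h2 : 8 * eps <= s j * s l * (Pi i j * Pi i l).
    have -> : s j * s l * (Pi i j * Pi i l) = `|Pi i j| * `|Pi i l|.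
      by rewrite !normrEsg /s; ring.
    by rewrite -theta2 expr2; apply: ler_pM; rewrite ?(ltW theta_gt0) ?heavy.
  by rewrite mulr0 mulrBr; lra.
have ge0 : 0 <= \sum_(j in C) \sum_(l in C) s j * s l * r j l.
  have -> : \sum_(j in C) \sum_(l in C) s j * s l * r j l =
      \sum_(k | k != i) (\sum_(j in C) s j * Pi k j) ^+ 2.
    rewrite /r; under eq_bigr do under eq_bigr do rewrite mulr_sumr.
    under eq_bigr do rewrite exchange_big /=.
    rewrite exchange_big /=; apply: eq_bigr => k _.
    rewrite expr2 mulr_suml; apply: eq_bigr => j _.
    by rewrite mulr_sumr; apply: eq_bigr => l _; ring.
  by apply: sumr_ge0 => k _; apply: sqr_ge0.
move/le_trans: ge0 => /(_ _ (ler_sum _ (fun j jC =>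
  ler_sum _ (fun l lC => term j l jC lC)))).
under eq_bigr => j _.
  rewrite sumrB -mulr_sumr sumr_const -[(6 * eps) *+ _]mulr_natl; over.
rewrite sumrB -mulr_sumr sumr_const -[_ *+ #|C|]mulr_natl.
set S := \sum_(j in C) _.
have S0 : 0 <= S by apply: sumr_ge0 => j _; apply: sumr_ge0.
(* Here [1 + 6 * eps <= 2], which turns [6 * eps] into the claimed [3 * eps]. *)
have : eps * S <= 6^-1 * S by apply: ler_wpM2r.
by rewrite expr2; lra.
Qed.
End Gram.

(** * Counting conflicts over all rows *)

Section Count.
Variables (R : realType) (m n : nat) (Pi : 'M[R]_(m, n)) (eps theta : R).
Hypotheses (eps_gt0 : 0 < eps) (eps_le : eps <= 6^-1).
Hypotheses (theta_gt0 : 0 < theta) (theta2 : theta ^+ 2 = 8 * eps).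

(** Cauchy-Schwarz against the all-ones vector. *)
Lemma sqr_sum_le (a : 'I_m -> R) :
  (\sum_i a i) ^+ 2 <= m%:R * \sum_i a i ^+ 2.
Proof.
apply: (@le_trans _ _ (\sum_(i < m) \sum_(k < m) (a i ^+ 2 + a k ^+ 2) / 2)).
  rewrite expr2 mulr_suml; apply: ler_sum => i _.
  rewrite mulr_sumr; apply: ler_sum => k _.
  by have := sqr_ge0 (a i - a k); rewrite sqrrB; lra.
rewrite le_eqVlt; apply/orP; left; apply/eqP.
under eq_bigr => i _.
  rewrite -mulr_suml big_split /= sumr_const card_ord -[_ *+ m]mulr_natl; over.
rewrite -mulr_suml big_split /= -mulr_sumr sumr_const card_ord -[_ *+ m]mulr_natl.
by field.
Qed.

(** The row bounds sum to [3 * eps] times the squared row counts, each pair is charged at most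
    [1 / (9 * eps)] times, and Cauchy-Schwarz relates the squares to [h ^ 2]; hence 27 as
    [9 * 3]. *)
Lemma conflicts_lb (G : {set 'I_n}) (h : R) :
  {in G, forall j, gram Pi j j <= (1 + eps) ^+ 2} ->
  (column_sparsity Pi)%:R <= 1 / (9 * eps) -> 0 <= h ->
  h <= \sum_(j in G) #|[set i : 'I_m | theta <= `|Pi i j|]|%:R ->
  27 * eps ^+ 2 * h ^+ 2 <=
    m%:R * \sum_(j in G) \sum_(l in G) (conflict Pi eps j l)%:R.
Proof.
move=> normal sparse h0 hG; pose N i := [set j in G | theta <= `|Pi i j|].
set S := \sum_(j in G) _.
have hN : \sum_(j in G) #|[set i : 'I_m | theta <= `|Pi i j|]|%:R
          = \sum_i #|N i|%:R :> R.
  transitivity (\sum_(j in G) \sum_i (theta <= `|Pi i j|)%R%:R : R).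
    by apply: eq_bigr => j _; rewrite -sum1dep_card big_mkcond natr_sum.
  rewrite exchange_big; apply: eq_bigr => i _.
  rewrite -sum1dep_card natr_sum [LHS]big_mkcond [RHS]big_mkcond.
  by apply: eq_bigr => j _; case: (j \in G) => //=; case: (theta <= _).
(* Heaviness of [l] is dropped on the right: a pair is charged to each row where its first column is
   heavy, which the column sparsity bounds. *)
have rowN i : 3 * eps * #|N i|%:R ^+ 2 <=
    \sum_(j in G) \sum_(l in G)
      (theta <= `|Pi i j|)%R%:R * (conflict Pi eps j l)%:R.
  apply: (@le_trans _ _ (\sum_(j in N i) \sum_(l in N i) (conflict Pi eps j l)%:R)).
    apply: (heavy_row_conflicts (ltW eps_gt0) eps_le theta_gt0 theta2 (i := i)).
      by move=> j; rewrite inE => /andP[].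
    by move=> j; rewrite inE => /andP[jG _]; apply: normal.
  rewrite [leLHS]big_mkcond [leRHS]big_mkcond; apply: ler_sum => j _.
  rewrite inE; case: (j \in G) => //=; case: (theta <= _).
    rewrite [leLHS]big_mkcond [leRHS]big_mkcond; apply: ler_sum => l _.
    by rewrite inE mul1r; case: (l \in G) => //=; case: (theta <= _).
  by apply: sumr_ge0 => l _; rewrite mul0r.
have sumS : \sum_i 3 * eps * #|N i|%:R ^+ 2 <= 1 / (9 * eps) * S.
  apply: le_trans (ler_sum _ (fun i _ => rowN i)) _.
  rewrite exchange_big /= mulr_sumr; apply: ler_sum => j jG.
  rewrite exchange_big /= mulr_sumr; apply: ler_sum => l lG.
  rewrite -mulr_suml; apply: ler_wpM2r => //.
  apply: le_trans sparse; rewrite -natr_sum ler_nat.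
  apply: leq_trans (leq_bigmax j); rewrite -sum1dep_card [leqRHS]big_mkcond.
  apply: leq_sum => i _; case: (boolP (theta <= _)) => // ij.
  by case: eqP => // pi0; rewrite pi0 normr0 leNgt theta_gt0 in ij.
have hsq : h ^+ 2 <= m%:R * \sum_i #|N i|%:R ^+ 2.
  apply: le_trans (sqr_sum_le _); rewrite lerXn2r ?nnegrE ?sumr_ge0 //.
  by rewrite -hN.
apply: (@le_trans _ _ (9 * eps * (m%:R * (1 / (9 * eps) * S)))); last first.
  rewrite le_eqVlt; apply/orP; left; apply/eqP.
  by field; rewrite gt_eqF.
apply: (@le_trans _ _ (9 * eps * (m%:R * (3 * eps * \sum_i #|N i|%:R ^+ 2)))).
  have -> : 27 * eps ^+ 2 * h ^+ 2 = 9 * eps * (3 * eps * h ^+ 2) by ring.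
  rewrite ler_pM2l ?mulr_gt0 // [leRHS]mulrCA ler_pM2l ?mulr_gt0 //.
rewrite ler_pM2l ?mulr_gt0 // ler_wpM2l // mulr_sumr //.
Qed.

End Count.

(** * What an embedding says about sampled columns *)

Section Embedding.
Variables (R : realType) (m n d : nat).

Lemma l2norm_sqr k (v : 'cV[R]_k) : l2norm v ^+ 2 = \sum_i v i 0 ^+ 2.
Proof. by rewrite sqr_sqrtr // sumr_ge0 // => i _; rewrite sqr_ge0. Qed.

Lemma col_D1_U (w : D1_sample n d) k :
  col k (D1_U R w) = (-1) ^+ w.2 k *: delta_mx (w.1 k) 0.
Proof.
apply/matrixP => i j; rewrite ord1 !mxE (bigD1 k) //= big1 => [|l lk].
  by rewrite !mxE eqxx mulr1n andbT addr0 mulrC.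
by rewrite !mxE (negbTE lk) mulr0n mulr0.
Qed.

(** The signs of [W] cancel against the same signs placed in [x]. *)
Lemma D1_U_pair (w : D1_sample n d) k l (a b : R) :
  exists x : 'cV[R]_d,
    D1_U R w *m x = a *: delta_mx (w.1 k) 0 + b *: delta_mx (w.1 l) 0.
Proof.
exists ((a * (-1) ^+ w.2 k) *: delta_mx k 0 + (b * (-1) ^+ w.2 l) *: delta_mx l 0).
rewrite mulmxDr -!scalemxAr -!colE !col_D1_U !scalerA -!mulrA -!expr2.
by rewrite !sqrr_sign !mulr1.
Qed.

Variables (Pi : 'M[R]_(m, n)) (eps : R).
Hypotheses (eps_ge0 : 0 <= eps) (eps_le1 : eps <= 1).

Lemma sqr_norm_comb (j l : 'I_n) (a b : R) :
  l2norm (Pi *m (a *: delta_mx j 0 + b *: delta_mx l 0)) ^+ 2 =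
  a ^+ 2 * gram Pi j j + 2 * a * b * gram Pi j l + b ^+ 2 * gram Pi l l.
Proof.
rewrite l2norm_sqr mulmxDr -!scalemxAr -!colE /gram !mulr_sumr -!big_split /=.
by apply: eq_bigr => i _; rewrite !mxE; ring.
Qed.

Lemma sqr_norm_basis (j l : 'I_n) (a b : R) : j != l ->
  l2norm (a *: delta_mx j 0 + b *: delta_mx l 0 : 'cV[R]_n) ^+ 2 = a ^+ 2 + b ^+ 2.
Proof.
move=> jl; have lj : l != j by rewrite eq_sym.
rewrite l2norm_sqr (bigD1 j) //= (bigD1 l) //= big1.
  by rewrite !mxE !eqxx (negbTE jl) (negbTE lj) /=; ring.
move=> i /andP[ij il]; rewrite !mxE (negbTE ij) (negbTE il) /=; ring.
Qed.

Definition embedded (U : 'M[R]_(n, d)) := forall x : 'cV[R]_d,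
  (1 - eps) * l2norm (U *m x) <= l2norm (Pi *m U *m x) /\
  l2norm (Pi *m U *m x) <= (1 + eps) * l2norm (U *m x).

Lemma embedded_sqr (w : D1_sample n d) k l (a b : R) (v : 'cV[R]_n) :
  embedded (D1_U R w) -> v = a *: delta_mx (w.1 k) 0 + b *: delta_mx (w.1 l) 0 ->
  (1 - eps) ^+ 2 * l2norm v ^+ 2 <= l2norm (Pi *m v) ^+ 2 <=
  (1 + eps) ^+ 2 * l2norm v ^+ 2.
Proof.
move=> emb ->; have [x <-] := D1_U_pair w k l a b.
have [] := emb x; rewrite -mulmxA => lo hi; rewrite -!exprMn.
have p0 : 0 <= 1 - eps by rewrite subr_ge0.
have p1 : 0 <= 1 + eps by rewrite addr_ge0.
by rewrite !lerXn2r ?nnegrE ?mulr_ge0 ?sqrtr_ge0.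
Qed.

(** Test a single basis vector, then [e_k + e_l] and [e_k - e_l], both of squared norm 2 for
    distinct columns. By polarization four times the inner product is at most [2 * ((1 + eps) ^ 2 -
    (1 - eps) ^ 2) = 8 * eps] in absolute value. *)
Lemma embedded_gram (w : D1_sample n d) : embedded (D1_U R w) ->
  (forall k, gram Pi (w.1 k) (w.1 k) <= (1 + eps) ^+ 2) /\
  (forall k l, w.1 k != w.1 l -> ~~ conflict Pi eps (w.1 k) (w.1 l)).
Proof.
move=> emb; split=> [k|k l kl].
  have /andP[_] := embedded_sqr (k := k) (l := k) (a := 1) (b := 0) emb erefl.
  rewrite sqr_norm_comb scale0r addr0 scale1r l2norm_sqr (bigD1 (w.1 k)) //= big1.
    by rewrite !mxE !eqxx /=; lra.
  by move=> i ik; rewrite !mxE (negbTE ik) expr0n.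
have /andP[lo hi] := embedded_sqr (k := k) (l := l) (a := 1) (b := 1) emb erefl.
have /andP[] := embedded_sqr (k := k) (l := l) (a := 1) (b := -1) emb erefl.
move: lo hi; rewrite !sqr_norm_comb !sqr_norm_basis // sqrrN !expr1n !mul1r.
move=> lo1 hi1 lo2 hi2; rewrite /conflict -leNgt ler_norml.
have e1 : (1 + eps) ^+ 2 = (1 - eps) ^+ 2 + 4 * eps by ring.
by rewrite e1 in hi1 hi2; apply/andP; split; lra.
Qed.

(** The mass function is constant and [bad] sees only the positions in [V], so the [2 ^ d] sign
    patterns sum out. *)
Lemma D1_Pr_le (E : 'M[R]_(n, d) -> Prop) (bad : pred {ffun 'I_d -> 'I_n}) :
  (0 < n)%N -> (forall w, E (D1_U R w) -> ~~ bad w.1) ->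
  D1_Pr E <= 1 - mean (fun w => (bad w)%:R).
Proof.
move=> n0 Ebad; have n0' : (0 < #|'I_n|)%N by rewrite card_ord.
rewrite -[X in X - _](mean_cst 'I_d (1 : R) n0') -meanB /mean.
have pmfE (w : D1_sample n d) : D1_pmf R w = #|{ffun 'I_d -> 'I_n}|%:R^-1 / (2 ^+ d).
  rewrite /D1_pmf /unif !prodr_const !card_ord card_bool card_ffun !card_ord.
  by rewrite natrX !exprVn.
rewrite /D1_Pr big_mkcond /=.
apply: (@le_trans _ _ (\sum_(w : D1_sample n d)
    (1 - (bad w.1)%:R) * (#|{ffun 'I_d -> 'I_n}|%:R^-1 / (2 ^+ d)))).
  apply: ler_sum => w _; rewrite pmfE; case: asboolP => [/Ebad/negbTE->|_].
    by rewrite subr0 mul1r.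
  by rewrite mulr_ge0 ?divr_ge0 ?exprn_ge0 ?invr_ge0 // subr_ge0 lern1 leq_b1.
rewrite -mulr_suml -(pair_big xpredT xpredT (fun w _ => 1 - (bad w)%:R)) /=.
under eq_bigr do
  rewrite sumr_const card_ffun card_bool card_ord -[(_ - _) *+ _]mulr_natr natrX.
by rewrite -mulr_suml mulrA mulrAC mulfK // expf_neq0 // pnatr_eq0.
Qed.

Lemma embedding_mean_le (delta : R) (bad : pred {ffun 'I_d -> 'I_n}) :
  (0 < n)%N -> (forall w, embedded (D1_U R w) -> ~~ bad w.1) ->
  subspace_embedding_D1 d eps delta Pi -> mean (fun w => (bad w)%:R : R) <= delta.
Proof. by move=> n0 /(D1_Pr_le n0) Pr emb; have := le_trans emb Pr; lra. Qed.

End Embedding.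

(** * Few edges in sparse subgraphs against many conflicts *)

Section Main.
Variables (R : realType) (eps delta : R) (m n d : nat) (Pi : 'M[R]_(m, n)).
Hypotheses (eps_gt0 : 0 < eps) (eps_lt : eps < 6^-1).
Hypotheses (delta_lt : delta < 4000^-1).
Hypotheses (d_gt1 : (1 < d)%N) (n_ge : 48 * d%:R ^+ 2 <= n%:R :> R).
Hypothesis sparse : (column_sparsity Pi)%:R <= 1 / (9 * eps).
Hypothesis emb : subspace_embedding_D1 d eps delta Pi.

Let theta := Num.sqrt (8 * eps).
(** Distinctness is imposed because a column sampled twice has a large inner product with itself
    without violating the embedding. *)
Let edge : rel 'I_n := fun x y => (x != y) && conflict Pi eps x y.

Let large_n : (d <= n)%N /\ (0 < n)%N.
Proof.
have dn : (d <= n)%N.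
  rewrite -(ler_nat R); apply: le_trans n_ge.
  have d1 : 1 < d%:R :> R by rewrite ltr1n.
  by rewrite expr2; nra.
by split=> //; apply: leq_trans dn; apply: ltnW.
Qed.

Let n_gt0 : (0 < n)%N := large_n.2.
Let nR_gt0 : 0 < n%:R :> R. Proof. by rewrite ltr0n. Qed.
Let dR_ge1 : 1 <= d%:R :> R. Proof. by rewrite ler1n ltnW. Qed.

(** One sampled index is uniform, and hitting a long column breaks the embedding. *)
Lemma long_columns_le :
  #|[set j | (1 + eps) ^+ 2 < gram Pi j j]|%:R <= delta * n%:R.
Proof.
have eps0 := ltW eps_gt0.
pose long (j : 'I_n) := (1 + eps) ^+ 2 < gram Pi j j.
pose k0 : 'I_d := Ordinal (ltnW d_gt1).
have eps1 : eps <= 1 by have := eps_lt; lra.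
have : mean (fun w : {ffun 'I_d -> 'I_n} => (long (w k0))%:R : R) <= delta.
  apply: (embedding_mean_le (bad := fun w => long (w k0)) n_gt0 _ emb).
  move=> w /(embedded_gram eps0 eps1)[/(_ k0) wk _].
  by rewrite /long -leNgt.
rewrite (mean_coord k0 (fun j => (long j)%:R)) ?card_ord // ler_pdivrMr //.
rewrite -natr_sum => h; apply: le_trans h.
by rewrite ler_nat -sum1dep_card big_mkcond.
Qed.

Lemma sparse_subgraph (e : rel 'I_n) : symmetric e -> subrel e edge ->
  (forall x, #|[set y | e x y]| <= n %/ d)%N ->
  200 * d%:R ^+ 2 * (\sum_x \sum_y (e x y)%:R) <= n%:R ^+ 2 :> R.
Proof.
move=> e_sym sub deg; set S := \sum_x _.
have eps1 : eps <= 1 by have := eps_lt; lra.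
have irr : irreflexive e.
  by move=> x; apply/negP => /sub/andP[]; rewrite eqxx.
have cn : (0 < #|'I_n|)%N by rewrite card_ord.
have cd : (1 < #|'I_d|)%N by rewrite card_ord.
have deg' x : (#|[set y | e x y]| * #|'I_d| <= #|'I_n|)%N.
  by rewrite !card_ord -leq_divRL ?deg // ltnW.
have := prob_edge_lb R cn cd e_sym irr deg'.
rewrite /= !card_ord -/S; set B := _ ^+ 2 * _ => lb.
have B0 : 0 <= B.
  rewrite mulr_ge0 ?divr_ge0 ?sqr_ge0 // sumr_ge0 // => x _.
  by rewrite sumr_ge0.
have ub : mean (fun w : {ffun 'I_d -> 'I_n} =>
    [exists k, exists l, e (w k) (w l)]%:R : R) <= delta.
  apply: (embedding_mean_le
    (bad := fun w => [exists k, exists l, e (w k) (w l)]) n_gt0 _ emb).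
  move=> w /(embedded_gram (ltW eps_gt0) eps1)[_ wkl].
  apply/existsP => -[k /existsP[l /sub/andP[kl]]].
  by apply/negP/wkl.
(* From [B / 2 / (8 + B) < 1 / 4000] follows [200 * B <= 1]. *)
have := le_lt_trans (le_trans lb ub) delta_lt.
rewrite ltr_pdivrMr => [|]; last lra.
have -> : 200 * d%:R ^+ 2 * S = 200 * B * n%:R ^+ 2.
  by rewrite /B; field; rewrite gt_eqF.
by move=> h; rewrite ler_piMl ?sqr_ge0 //; lra.
Qed.

Lemma sqr_dim_lt_rows :
  1 / (12 * eps) <= avg_heavy theta Pi -> (d ^ 2 < m)%N.
Proof.
move=> avg; rewrite ltnNge; apply/negP => md.
have edge_sym : symmetric edge.
  by move=> x y; rewrite /edge /conflict gramC eq_sym.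
have edge_irr : irreflexive edge by move=> x; rewrite /edge eqxx.
have [e [e_sym e_sub e_deg e_max]] :=
  maximal_bounded_subgraph (n %/ d) edge_sym edge_irr.
have few := sparse_subgraph e_sym e_sub e_deg.
set E := \sum_x _ in few.
pose S := [set x | (n %/ d <= #|[set z | e x z]|)%N].
pose L := [set j | (1 + eps) ^+ 2 < gram Pi j j].
(* As [d <= n], the quotient is positive and rounding down costs at most a factor 2. *)
have halfD : n%:R <= 2 * (d%:R * (n %/ d)%:R) :> R.
  rewrite -!natrM ler_nat.
  have D1 : (0 < n %/ d)%N by rewrite divn_gt0 ?(ltnW d_gt1) // large_n.1.
  apply: leq_trans (ltnW (ltn_ceil n (ltnW d_gt1))) _.
  by rewrite mulnC mulnCA leq_mul2l mul2n -addnn -addn1 leq_add2l D1 orbT.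
have SE : #|S|%:R * (n %/ d)%:R <= E.
  rewrite -natrM /E -sum_nat_const natr_sum big_mkcond; apply: ler_sum => x _.
  rewrite inE; case: leqP => [h|_]; last by rewrite sumr_ge0.
  apply: (@le_trans _ _ #|[set z | e x z]|%:R); first by rewrite ler_nat.
  by rewrite -sum1dep_card -natr_sum ler_nat big_mkcond.
(* With [D = n %/ d]: [100 n |S| <= 200 d D |S| <= 200 d ^ 2 E <= n ^ 2]. *)
have Sn : 100 * #|S|%:R <= n%:R :> R.
  rewrite -(ler_pM2l nR_gt0) -expr2; apply: le_trans few.
  have E0 : 0 <= E by rewrite sumr_ge0 // => x _; rewrite sumr_ge0.
  apply: (@le_trans _ _ (200 * d%:R * E)); last first.
    by rewrite ler_wpM2r // ler_wpM2l // expr2 ler_peMl.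
  apply: (@le_trans _ _ (200 * d%:R * (#|S|%:R * (n %/ d)%:R))); last first.
    by rewrite ler_wpM2l // mulr_ge0.
  have -> : 200 * d%:R * (#|S|%:R * (n %/ d)%:R) =
      2 * (d%:R * (n %/ d)%:R) * (100 * #|S|%:R) :> R by ring.
  by rewrite ler_wpM2r // mulr_ge0.
have Ln := long_columns_le; rewrite -/L in Ln.
pose G := ~: (S :|: L).
pose H j := #|[set i : 'I_m | theta <= `|Pi i j|]|.
have theta0 : 0 < theta by rewrite sqrtr_gt0 mulr_gt0.
have theta2 : theta ^+ 2 = 8 * eps by rewrite sqr_sqrtr // mulr_ge0 // ltW.
have Hle j : (H j)%:R <= 1 / (9 * eps).
  apply: le_trans sparse; rewrite ler_nat.
  apply: leq_trans (leq_bigmax j); apply/subset_leq_card/subsetP => i.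
  by rewrite !inE; apply: contraTneq => ->; rewrite normr0 -ltNge.
(* At most 4 percent of the columns are discarded, each with at most [1 / (9 * eps)] heavy entries;
   this is below the slack between [1 / 12] and [1 / 18]. *)
have HG : n%:R / (18 * eps) <= \sum_(j in G) (H j)%:R.
  have avgH : n%:R / (12 * eps) <= \sum_j (H j)%:R.
    move: avg; rewrite /avg_heavy /unif -mulr_sumr card_ord [leRHS]mulrC.
    by rewrite ler_pdivlMr // mulrC mul1r.
  rewrite (bigID (mem G)) /= in avgH.
  have out : \sum_(j | j \notin G) (H j)%:R <= #|S :|: L|%:R * (1 / (9 * eps)).
    apply: le_trans (ler_sum _ (fun j _ => Hle j)) _.
    rewrite sumr_const -[_ / _ *+ _]mulr_natl (eq_card (B := S :|: L)) // => j.
    by rewrite unfold_in /= inE negbK.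
  have SL : #|S :|: L|%:R <= 4 / 100 * n%:R :> R.
    apply: (@le_trans _ _ (#|S|%:R + #|L|%:R)).
      by rewrite -natrD ler_nat cardsU leq_subr.
    have : delta * n%:R <= 4000^-1 * n%:R by rewrite ler_wpM2r // ltW.
    have := nR_gt0; lra.
  have out2 : #|S :|: L|%:R * (1 / (9 * eps)) <= 4 / 100 * n%:R * (1 / (9 * eps)).
    by rewrite ler_wpM2r // divr_ge0 // mulr_ge0 // ltW.
  have t0 : 0 <= n%:R / eps by rewrite divr_ge0 // ltW.
  have e12 : n%:R / (12 * eps) = 12^-1 * (n%:R / eps) by field; rewrite gt_eqF.
  have e18 : n%:R / (18 * eps) = 18^-1 * (n%:R / eps) by field; rewrite gt_eqF.
  have e9 : 4 / 100 * n%:R * (1 / (9 * eps)) = 4 / 900 * (n%:R / eps).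
    by field; rewrite gt_eqF.
  by rewrite e12 in avgH; rewrite e9 in out2; rewrite e18; lra.
have normal : {in G, forall j, gram Pi j j <= (1 + eps) ^+ 2}.
  by move=> j; rewrite !inE negb_or => /andP[_]; rewrite -leNgt.
have h0 : 0 <= n%:R / (18 * eps) by rewrite divr_ge0 // mulr_ge0 // ltW.
have := conflicts_lb eps_gt0 (ltW eps_lt) theta0 theta2 normal sparse h0 HG.
have -> : 27 * eps ^+ 2 * (n%:R / (18 * eps)) ^+ 2 = n%:R ^+ 2 / 12.
  by field; rewrite gt_eqF.
set C := \sum_(j in G) _ => lb.
(* The diagonal accounts for [n]; other conflicts join unsaturated columns, so maximality puts them
   in [e]. *)
have CE : C <= E + n%:R.
  have -> : n%:R = \sum_(x < n) \sum_(y < n) (x == y)%:R :> R.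
    under eq_bigr => x _.
      rewrite (bigD1 x) //= big1 => [|y]; last by rewrite eq_sym => /negbTE->.
      rewrite eqxx addr0; over.
    by rewrite sumr_const card_ord.
  rewrite /C /E -big_split big_mkcond; apply: ler_sum => x _ /=.
  rewrite -big_split big_mkcond /=.
  case: (boolP (x \in G)) => [xG|_].
    2: by apply: sumr_ge0 => y _; rewrite addr_ge0.
  rewrite big_mkcond; apply: ler_sum => y _.
  case: (boolP (y \in G)) => [yG|_]; last by rewrite addr_ge0.
  have [_|xy] := eqVneq x y.
    by rewrite (@le_trans _ _ 1) ?lern1 ?leq_b1 // lerDr.
  rewrite addr0 ler_nat; case: (boolP (conflict _ _ _ _)) => // cxy.
  move: xG yG; rewrite !inE !negb_or -!ltnNge => /andP[xS _] /andP[yS _].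
  by rewrite e_max // /edge xy.
have mC : m%:R * C <= d%:R ^+ 2 * (E + n%:R).
  apply: ler_pM; rewrite ?ler0n // -?natrX ?ler_nat //.
  by rewrite sumr_ge0 // => x _; rewrite sumr_ge0.
(* Now [m * C] is at most [n ^ 2 / 200 + n ^ 2 / 48], below the lower bound [n ^ 2 / 12]. *)
have nn : 48 * d%:R ^+ 2 * n%:R <= n%:R ^+ 2 :> R by rewrite expr2 ler_wpM2r.
have : 0 < n%:R ^+ 2 :> R by rewrite exprn_gt0.
rewrite mulrDr in mC; lra.
Qed.

End Main.

Theorem theorem7 (R : realType) :
  exists eps0 delta0 K0 : R,
    [/\ 0 < eps0, 0 < delta0 & 0 < K0] /\
    forall (eps delta : R) (m n d : nat) (Pi : 'M[R]_(m, n)),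
      0 < eps -> eps < eps0 ->
      0 < delta -> delta < delta0 ->
      1 / eps ^+ 2 <= d%:R ->
      K0 * d%:R ^+ 2 / delta <= n%:R ->
      (column_sparsity Pi)%:R <= 1 / (9 * eps) ->
      1 / (12 * eps) <= avg_heavy (Num.sqrt (8 * eps)) Pi ->
      subspace_embedding_D1 d eps delta Pi ->
      (d ^ 2 < m)%N.
Proof.
exists 6^-1, 4000^-1, 48; split; first by split; rewrite ?invr_gt0 ?ltr0n.
move=> eps delta m n d Pi e0 e6 d0 d4 ed nd sparse avg emb.
apply: (sqr_dim_lt_rows e0 e6 d4 _ _ sparse emb avg).
  (* Since [eps < 1], the bound [1 / eps ^ 2 <= d] gives at least two sampled columns. *)
  rewrite -(ltr_nat R); apply: lt_le_trans ed; rewrite ltr_pdivlMr ?exprn_gt0 //.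
  by rewrite mul1r expr_lt1 ?(ltW e0) //; lra.
apply: le_trans nd; rewrite ler_pdivlMr // ler_piMr //; last lra.
by rewrite mulr_ge0 // sqr_ge0.
Qed.
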